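(* Suppose that for every $v_i\in\mathcal V$ the function $f_i:\mathbb R^d\to\mathbb R$ is convex with $\operatorname{argmin} f_i$ non-empty and bounded, and that there is $L>0$ such that $\|g\|_2\le L$ for all $v_i\in\mathcal V$, $x\in\mathbb R^d$ and $g\in\partial f_i(x)$. Let $x^*$ be a solution of $$\min_{x\in\mathbb R^d}\frac1{|\mathcal R|}\sum_{v_i\in\mathcal R}f_i(x).$$ Then $x^*\in\mathcal B(\hat x,R^* )$, where $$R^*=\inf_{\epsilon>0}\Big\{\max_{v_i\in\mathcal R}\max\{\tilde R_i\sec\theta_i(\epsilon),\ \tilde R_i+\delta_i(\epsilon)\}\Big\}.$$
   Context: $\mathcal V$ is a finite set of nodes and $\mathcal R\subseteq\mathcal V$ the non-empty subset of regular nodes. $\partial f_i$ is the subdifferential. $\mathcal B(x_0,r)=\{x\in\mathbb R^d:\|x-x_0\|_2\le r\}$ and $\angle(u,v)=\arccos\big(\langle u,v\rangle/(\|u\|_2\|v\|_2)\big)$. $\hat x\in\mathbb R^d$ is a fixed vector (the auxiliary point, obtained by the regular nodes through a resilient consensus procedure; no other property of it is used). For $v_i\in\mathcal R$, $x_i^*$ is a fixed minimizer of $f_i$ and $\tilde R_i=\|x_i^*-\hat x\|_2$. For $\epsilon>0$: $\mathcal C_i(\epsilon)=\{x:f_i(x)\le f_i(x_i^* )+\epsilon\}$; $\delta_i(\epsilon)\in(0,\infty)$ is a number with $\mathcal C_i(\epsilon)\subseteq\mathcal B(x_i^*,\delta_i(\epsilon))$; and $\theta_i(\epsilon)\in[0,\pi/2)$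 is a number with $\angle(-g,\,x_i^*-x)\le\theta_i(\epsilon)$ for all $x\notin\mathcal C_i(\epsilon)$ and $g\in\partial f_i(x)$. (Such numbers exist under the stated hypotheses; a choice is fixed for every $i$ and $\epsilon$.) *)

(* Defs.v *)
From mathcomp Require Import all_boot all_order all_algebra.
From mathcomp Require Import all_classical all_reals all_analysis.

Set Implicit Arguments.
Unset Strict Implicit.
Unset Printing Implicit Defensive.

Import Order.TTheory GRing.Theory Num.Theory.
Import numFieldNormedType.Exports.

Local Open Scope classical_set_scope.
Local Open Scope ring_scope.

(* The canonical norm `|x| on 'rV[R]_d is the sup norm, so the Euclidean
   structure of R^d is set up separately here. *)
Definition dotv (R : realType) (d : nat) (u v : 'rV[R]_d) : R :=
  \sum_(k < d) u ord0 k * v ord0 k.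

Definition norm2 (R : realType) (d : nat) (x : 'rV[R]_d) : R :=
  Num.sqrt (dotv x x).

Definition ball2 (R : realType) (d : nat) (x0 : 'rV[R]_d) (r : R) :
    set 'rV[R]_d :=
  [set x | norm2 (x - x0) <= r].

(* Meaningful for nonzero u and v; otherwise it is acos 0 = pi / 2, because
   division by 0 yields 0. *)
Definition angle (R : realType) (d : nat) (u v : 'rV[R]_d) : R :=
  acos (dotv u v / (norm2 u * norm2 v)).

Definition argmin (R : realType) (d : nat) (f : 'rV[R]_d -> R) :
    set 'rV[R]_d :=
  [set x | forall y, f x <= f y].

Definition subdifferential (R : realType) (d : nat) (f : 'rV[R]_d -> R)
    (x : 'rV[R]_d) : set 'rV[R]_d :=
  [set g | forall y, f x + dotv g (y - x) <= f y].

(* C_i(eps), for f = f_i and xs = x_i^* *)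
Definition sublevel (R : realType) (d : nat) (f : 'rV[R]_d -> R)
    (xs : 'rV[R]_d) (eps : R) : set 'rV[R]_d :=
  [set x | f x <= f xs + eps].

Definition average (R : realType) (d : nat) (V : finType) (Reg : {set V})
    (f : V -> 'rV[R]_d -> R) (x : 'rV[R]_d) : R :=
  #|Reg|%:R^-1 * \sum_(i in Reg) f i x.

Definition sec (R : realType) (t : R) : R := (cos t)^-1.

(* The quantity minimized over eps in Rstar below. Starting the big maximum at
   0 is harmless: in use Reg is nonempty and norm2 (xs i - xh) + delta i eps
   is positive for every i in Reg. *)
Definition radius (R : realType) (d : nat) (V : finType) (Reg : {set V})
    (xh : 'rV[R]_d) (xs : V -> 'rV[R]_d) (delta theta : V -> R -> R)
    (eps : R) : R :=
  \big[Num.max/0]_(i in Reg)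
    Num.max (norm2 (xs i - xh) * sec (theta i eps))
            (norm2 (xs i - xh) + delta i eps).

(* The set below is nonempty and bounded from below by 0, so the real-valued
   inf is its greatest lower bound. *)
Definition Rstar (R : realType) (d : nat) (V : finType) (Reg : {set V})
    (xh : 'rV[R]_d) (xs : V -> 'rV[R]_d) (delta theta : V -> R -> R) : R :=
  inf [set radius Reg xh xs delta theta eps | eps in [set e : R | 0 < e]].

(* Main.v *)
(* If |xstar - xh| exceeds the radius for some eps, then for each regular i the
   point xstar lies outside C_i(eps), and for every subgradient g of f_i there
   -g makes an angle at most theta_i with x_i^* - xstar; since the latter makes
   an angle less than pi / 2 - theta_i with xh - xstar, <g, xh - xstar> < 0.
   Hence every f_i strictly decreases from xstar along xh - xstar, for otherwise
   Hahn-Banach applied to the directional derivative would give a subgradient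
   with <g, xh - xstar> >= 0. A short common step then decreases the average. *)

Require Import Defs.
From mathcomp Require Import all_boot all_order all_algebra.
From mathcomp Require Import all_classical all_reals all_analysis.
From mathcomp Require Import ring lra.
Set Implicit Arguments.
Unset Strict Implicit.

Import Order.TTheory GRing.Theory Num.Theory.
Import numFieldNormedType.Exports.
Local Open Scope classical_set_scope.
Local Open Scope ring_scope.

(** * Infima over the positive reals *)

Section InfPos.
Context {R : realType}.
Implicit Types F G H : R -> R.

Definition inf_pos F : R := inf [set F t | t in [set t : R | 0 < t]].

Lemma inf_pos_ge F m : (forall t, 0 < t -> m <= F t) -> m <= inf_pos F.
Proof.
move=> mF; apply: lb_le_inf; first by exists (F 1), 1 => //=; exact: ltr01.
by move=> _ [t t0 <-]; exact: mF.
Qed.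

(** A lower bound [m] is assumed because [inf] takes a default value on sets unbounded below. *)
Lemma inf_pos_le F m t : (forall s, 0 < s -> m <= F s) -> 0 < t ->
  inf_pos F <= F t.
Proof.
move=> mF t0; apply: ge_inf; last by exists t.
by exists m => _ [s s0 <-]; exact: mF.
Qed.

Lemma inf_pos_leD F G H m : (forall t, 0 < t -> m <= H t) ->
  (forall s t, 0 < s -> 0 < t -> exists2 r, 0 < r & H r <= F s + G t) ->
  inf_pos H <= inf_pos F + inf_pos G.
Proof.
move=> mH HFG; rewrite -lerBlDr; apply: inf_pos_ge => s s0.
rewrite lerBlDr -lerBlDl; apply: inf_pos_ge => t t0; rewrite lerBlDl.
have [r r0] := HFG _ _ s0 t0; apply: le_trans; exact: inf_pos_le mH r0.
Qed.

Lemma inf_pos_leM F G m a : 0 < a -> (forall t, 0 < t -> m <= G t) ->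
  (forall s, 0 < s -> exists2 r, 0 < r & G r <= a * F s) ->
  inf_pos G <= a * inf_pos F.
Proof.
move=> a0 mG GF; rewrite -ler_pdivrMl//; apply: inf_pos_ge => s s0.
rewrite ler_pdivrMl//; have [r r0] := GF _ s0; apply: le_trans.
exact: inf_pos_le mG r0.
Qed.

End InfPos.

(** * Sublinear functionals and Hahn-Banach steps *)

Section Sublinear.
Context {R : realType} {E : lmodType R}.
Implicit Types (p q : E -> R) (u v w : E).

Definition sublinear p :=
  (forall a v, 0 < a -> p (a *: v) <= a * p v) /\
  (forall u v, p (u + v) <= p u + p v).

Lemma sublinearZ p a v : sublinear p -> 0 < a -> p (a *: v) = a * p v.
Proof.
move=> [pZ _] a0; apply/eqP; rewrite eq_le pZ//=.
have ai0 : 0 < a^-1 by rewrite invr_gt0.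
have := pZ a^-1 (a *: v) ai0.
by rewrite scalerA mulVf ?gt_eqF// scale1r ler_pdivlMl.
Qed.

Lemma sublinear0 p : sublinear p -> p 0 = 0.
Proof.
by move=> ps; have := sublinearZ 0 ps (ltr0Sn _ 1); rewrite scaler0; lra.
Qed.

(* q v = inf_(t > 0) (p (v + t w) - t p w), a one-step Hahn-Banach: for
   sublinear q, q (- w) = - q w says that q is linear on the line spanned
   by w. *)
Lemma sublinear_step p w : sublinear p ->
  exists q, [/\ sublinear q, (forall v, q v <= p v) & q (- w) <= - p w].
Proof.
move=> ps; have [pZ pD] := ps.
pose F v t := p (v + t *: w) - t * p w.
(* Subadditivity at [t *: w = (v + t *: w) + (- v)] bounds [F v] below, so its infimum is
   genuine. *)
have F_ge v t : 0 < t -> - p (- v) <= F v t.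
  move=> t0; rewrite /F -(sublinearZ _ ps)//.
  have := pD (v + t *: w) (- v); rewrite addrAC subrr add0r; lra.
exists (fun v => inf_pos (F v)); split.
- split=> [a v a0|u v].
  + apply: (inf_pos_leM a0 (F_ge _)) => s s0.
    exists (a * s); first exact: mulr_gt0.
    by rewrite /F -scalerA -scalerDr (sublinearZ _ ps)// mulrBr mulrA.
  + apply: (inf_pos_leD (F_ge _)) => s t s0 t0.
    exists (s + t); first exact: addr_gt0.
    have := pD (u + s *: w) (v + t *: w); rewrite /F addrACA -scalerDl; lra.
- move=> v; apply: le_trans (inf_pos_le (F_ge v) ltr01) _.
  by rewrite /F scale1r mul1r lerBlDr.
- apply: le_trans (inf_pos_le (F_ge _) ltr01) _.
  by rewrite /F scale1r mul1r addNr (sublinear0 ps) sub0r.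
Qed.

Lemma sublinear_steps p (s : seq E) : sublinear p ->
  exists q, [/\ sublinear q, (forall v, q v <= p v) &
    forall w, w \in s -> q (- w) <= - q w].
Proof.
elim: s p => [|w s IHs] p ps; first by exists p; split.
have [q [qs qp qw]] := sublinear_step w ps.
have [r [rs rq rw]] := IHs _ qs.
exists r; split=> // [v|v]; first exact: le_trans (rq v) (qp v).
rewrite inE => /predU1P[->|]; last exact: rw.
(* Linearity along [w] survives later steps: [r (- w) <= q (- w) <= - p w <= - r w]. *)
by rewrite (le_trans (rq _))// (le_trans qw)// lerN2 (le_trans (rq _)).
Qed.

End Sublinear.

(** * Euclidean inner product and linear minorants *)

Section Dot.
Context {R : realType} {d : nat}.
Implicit Types (u v w g : 'rV[R]_d) (a : R).

Lemma dotvC u v : dotv u v = dotv v u.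
Proof. by apply: eq_bigr => k _; rewrite mulrC. Qed.

Lemma dotvDr u v w : dotv u (v + w) = dotv u v + dotv u w.
Proof. by rewrite -big_split; apply: eq_bigr => k _; rewrite mxE mulrDr. Qed.

Lemma dotvZr a u v : dotv u (a *: v) = a * dotv u v.
Proof. by rewrite mulr_sumr; apply: eq_bigr => k _; rewrite mxE mulrCA. Qed.

Lemma dotvNr u v : dotv u (- v) = - dotv u v.
Proof. by rewrite -scaleN1r dotvZr mulN1r. Qed.

Lemma dotvBr u v w : dotv u (v - w) = dotv u v - dotv u w.
Proof. by rewrite dotvDr dotvNr. Qed.

Lemma dotvDl u v w : dotv (v + w) u = dotv v u + dotv w u.
Proof. by rewrite !(dotvC _ u) dotvDr. Qed.

Lemma dotvZl a u v : dotv (a *: u) v = a * dotv u v.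
Proof. by rewrite !(dotvC _ v) dotvZr. Qed.

Lemma dotvNl u v : dotv (- u) v = - dotv u v.
Proof. by rewrite !(dotvC _ v) dotvNr. Qed.

Lemma dotvBl u v w : dotv (v - w) u = dotv v u - dotv w u.
Proof. by rewrite !(dotvC _ u) dotvBr. Qed.

Lemma dotvv_ge0 u : 0 <= dotv u u.
Proof. by apply: sumr_ge0 => k _; rewrite -expr2 sqr_ge0. Qed.

Lemma norm2_ge0 u : 0 <= norm2 u.
Proof. exact: sqrtr_ge0. Qed.

Lemma sqr_norm2 u : norm2 u ^+ 2 = dotv u u.
Proof. exact: sqr_sqrtr (dotvv_ge0 u). Qed.

Lemma norm2N u : norm2 (- u) = norm2 u.
Proof. by rewrite /norm2 dotvNl dotvNr opprK. Qed.

Lemma norm2_eq0_dotv u v : norm2 u = 0 -> dotv u v = 0.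
Proof.
move=> u0; have /eqP : dotv u u = 0 by rewrite -sqr_norm2 u0 expr0n.
rewrite psumr_eq0 => [/allP uk0|k _]; last by rewrite -expr2 sqr_ge0.
apply: big1 => k _; have := uk0 k (mem_index_enum _).
by rewrite /= mulf_eq0 orbb => /eqP->; rewrite mul0r.
Qed.

(** Cauchy-Schwarz: for nonzero norms, expand the square of [norm2 v *: u - norm2 u *: v]. *)
Lemma dotv_le_norm2 u v : dotv u v <= norm2 u * norm2 v.
Proof.
have [u0|un0] := eqVneq (norm2 u) 0; first by rewrite norm2_eq0_dotv// u0 mul0r.
have [v0|vn0] := eqVneq (norm2 v) 0.
  by rewrite dotvC norm2_eq0_dotv// v0 mulr0.
have u_gt0 : 0 < norm2 u by rewrite lt_neqAle eq_sym un0 norm2_ge0.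
have v_gt0 : 0 < norm2 v by rewrite lt_neqAle eq_sym vn0 norm2_ge0.
have := dotvv_ge0 (norm2 v *: u - norm2 u *: v).
rewrite dotvBl !dotvBr !dotvZl !dotvZr -!sqr_norm2 (dotvC v u).
set m := norm2 u * norm2 v.
rewrite [leRHS](_ : _ = 2 * m * (m - dotv u v)); last by rewrite /m; ring.
by rewrite pmulr_rge0 ?subr_ge0// !mulr_gt0.
Qed.

Lemma ler_norm2D u v : norm2 (u + v) <= norm2 u + norm2 v.
Proof.
rewrite -(@ler_pXn2r _ 2) ?nnegrE ?addr_ge0 ?norm2_ge0//.
rewrite sqr_norm2 dotvDl !dotvDr (dotvC v u) sqrrD !sqr_norm2.
have := dotv_le_norm2 u v; rewrite mulr2n; lra.
Qed.

(* Making p linear along u and then along each basis vector yields a linear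
   functional below p that agrees with p at u. *)
Lemma sublinear_ge_dotv (p : 'rV[R]_d -> R) u : sublinear p ->
  exists2 g, (forall v, dotv g v <= p v) & p u <= dotv g u.
Proof.
move=> ps; have [q [qs qp qu]] := sublinear_step u ps.
have [r [rs rq rE]] := sublinear_steps [seq 'e_i | i <- enum 'I_d] qs.
have [rZ rD] := rs.
pose g := \row_k r 'e_k.
have rN v : - r (- v) <= r v.
  by have := rD v (- v); rewrite subrr (sublinear0 rs); lra.
have rgE v : r v <= dotv g v.
  rewrite [in r v](row_sum_delta v) /dotv.
  elim/big_ind2 : _ => [||k _]; first by rewrite (sublinear0 rs).
    by move=> x a y b xa yb; exact: le_trans (rD _ _) (lerD xa yb).
  rewrite mxE mulrC; have [vk0|vk0|->] := ltgtP (v ord0 k) 0.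
  (* A negative coordinate gives a positive multiple of [- 'e_k], where [rE] applies. *)
  - have ek : 'e_k \in [seq 'e_i : 'rV[R]_d | i <- enum 'I_d].
      by apply: map_f; rewrite mem_enum.
    rewrite -[v ord0 k *: _]opprK -scaleNr -scalerN
      (le_trans (rZ _ _ _)) ?oppr_gt0//.
    by rewrite -[leRHS]mulrNN ler_wpM2l ?oppr_ge0 ?(ltW vk0)// rE.
  - exact: rZ.
  - by rewrite scale0r mul0r (sublinear0 rs).
have gr v : dotv g v <= r v.
  by apply: le_trans (rN v); rewrite lerNr -dotvNr.
exists g => [v|]; first by rewrite (le_trans (gr v))// (le_trans (rq v)).
(* The chain is [p u <= - q (- u) <= - r (- u) <= r u <= dotv g u]. *)
rewrite (le_trans _ (rgE u))// (le_trans _ (rN u))//.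
by rewrite lerNr (le_trans (rq _)).
Qed.

End Dot.

(** * Convex functions, directional derivatives and subgradients *)

Section Convex.
Context {R : realType} {d : nat}.
Variable f : 'rV[R]_d -> R.
Hypothesis fconv : convex_function [set: 'rV[R]_d] f.
Implicit Types x y u v : 'rV[R]_d.

Lemma convex_functionE a b x y : 0 <= a -> 0 <= b -> a + b = 1 ->
  f (a *: x + b *: y) <= a * f x + b * f y.
Proof.
move=> a0 b0 ab; have a1 : a <= 1 by rewrite -ab lerDl.
have -> : b = 1 - a by rewrite -ab addrC addKr.
by have := @fconv (Itv01 a0 a1) x y; apply; rewrite inE.
Qed.

(** The nearer point is a convex combination with weight [s / t > 0] on the lower one. This lets
    separate descent steps be shortened to a common one. *)
Lemma convex_descent x u s t : 0 < s <= t -> f (x + t *: u) < f x ->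
  f (x + s *: u) < f x.
Proof.
move=> /andP[s0 st] ft; have t0 : 0 < t := lt_le_trans s0 st.
have /(_ (s / t) (1 - s / t) (x + t *: u) x) := convex_functionE.
rewrite divr_ge0 ?(ltW s0) ?(ltW t0)// subr_ge0 ler_pdivrMr// mul1r st.
rewrite addrC subrK => /(_ isT isT erefl).
rewrite scalerDr scalerA divfK ?gt_eqF// addrAC -scalerDl.
rewrite [_ + (1 - _)]addrC subrK scale1r.
move=> /le_lt_trans; apply.
have : 0 < s / t by rewrite divr_gt0.
nra.
Qed.

(** Difference quotients of a convex function are nondecreasing in [t], so this infimum is the
    one-sided directional derivative. *)
Definition dirderiv x v : R := inf_pos (fun t => (f (x + t *: v) - f x) / t).

Lemma convex_slopeD x u v s t : 0 < s -> 0 < t ->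
  exists2 r, 0 < r & (f (x + r *: (u + v)) - f x) / r <=
    (f (x + s *: u) - f x) / s + (f (x + t *: v) - f x) / t.
Proof.
move=> s0 t0; have st0 : 0 < s + t by rewrite addr_gt0.
(* With weights [t / (s + t)] and [s / (s + t)] on the two points, [u] and [v] both get coefficient
   [r]. *)
pose r := s * t / (s + t).
have r0 : 0 < r by rewrite divr_gt0// mulr_gt0.
exists r => //.
have := @convex_functionE (t / (s + t)) (s / (s + t)) (x + s *: u) (x + t *: v).
rewrite !divr_ge0 ?(ltW s0) ?(ltW t0) ?(ltW st0)// => /(_ isT isT).
rewrite -mulrDl [t + s]addrC divff ?gt_eqF// => /(_ erefl).
have -> : (t / (s + t)) *: (x + s *: u) + (s / (s + t)) *: (x + t *: v) =
    x + r *: (u + v).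
  rewrite !scalerDr !scalerA addrACA -scalerDl -mulrDl [t + s]addrC.
  rewrite divff ?gt_eqF//.
  by rewrite scale1r /r; congr (_ + (_ *: _ + _ *: _)); ring.
move=> fr; rewrite ler_pdivrMr// lerBlDr; apply: le_trans fr _.
rewrite le_eqVlt; apply/orP; left; apply/eqP; rewrite /r; field.
by rewrite !gt_eqF.
Qed.

Lemma convex_slope_ge x v t : 0 < t ->
  - (f (x - v) - f x) <= (f (x + t *: v) - f x) / t.
Proof.
move=> t0; have [r _] := convex_slopeD x v (- v) t0 ltr01.
by rewrite subrr scaler0 addr0 subrr mul0r scale1r divr1 -lerBlDr sub0r.
Qed.

Lemma dirderiv_le x v : dirderiv x v <= f (x + v) - f x.
Proof.
apply: le_trans (inf_pos_le (convex_slope_ge x v) ltr01) _.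
by rewrite scale1r divr1.
Qed.

Lemma sublinear_dirderiv x : sublinear (dirderiv x).
Proof.
split=> [a v a0|u v].
- apply: (inf_pos_leM a0 (convex_slope_ge x _)) => s s0.
  exists (s / a); first exact: divr_gt0.
  by rewrite scalerA divfK ?gt_eqF// invf_div mulrCA mulrC.
- apply: (inf_pos_leD (convex_slope_ge x _)) => s t.
  exact: convex_slopeD.
Qed.

(** A linear minorant of [dirderiv] at [x] is a subgradient, since [dirderiv] is at most the
    increment of [f]; one touching it at [u] is nonnegative there. *)
Lemma exists_subgradient x u : (forall t, 0 < t -> f x <= f (x + t *: u)) ->
  exists2 g, subdifferential f x g & 0 <= dotv g u.
Proof.
move=> fu; have [g gle gu] := sublinear_ge_dotv u (sublinear_dirderiv x).
exists g => [y|]; last first.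
  apply: le_trans gu; apply: inf_pos_ge => t t0.
  by rewrite divr_ge0 ?(ltW t0)// subr_ge0 fu.
have := le_trans (gle (y - x)) (dirderiv_le x _).
by rewrite [x + _]addrC subrK lerBrDl.
Qed.

End Convex.

(** * Angle estimates *)

Section Angle.
Context {R : realType} {d : nat}.
Implicit Types (a b c : 'rV[R]_d).

Lemma cos_gt0_acute (t : R) : 0 <= t < pi / 2 -> 0 < cos t.
Proof.
move=> /andP[t0 tpi]; rewrite cos_gt0_pihalf// tpi andbT.
by rewrite (lt_le_trans _ t0)// oppr_lt0 divr_gt0 ?pi_gt0.
Qed.

Lemma angle_le_dotv a b t : 0 <= t < pi / 2 -> 0 < dotv a b ->
  angle a b <= t -> norm2 a * norm2 b * cos t <= dotv a b.
Proof.
move=> /andP[t0 tpi] ab0 abt.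
have ab_gt0 : 0 < norm2 a * norm2 b := lt_le_trans ab0 (dotv_le_norm2 a b).
have q01 : -1 <= dotv a b / (norm2 a * norm2 b) <= 1.
  rewrite ler_pdivrMr// mul1r dotv_le_norm2 andbT (@le_trans _ _ 0)//.
  by rewrite divr_ge0// ltW.
rewrite mulrC -ler_pdivlMr//.
rewrite -[leRHS](@acosK R) ?in_itv//= leNgt ltr_cos -?leNgt//; last first.
- by rewrite in_itv/= acos_ge0// acos_lepi.
- rewrite in_itv/= t0 (le_trans (ltW tpi))// ler_pdivrMr// ler_peMr ?pi_ge0//.
  by rewrite ler1n.
Qed.

(* The angle between b and c is less than pi / 2 - t since the distance from c
   to the line spanned by b is less than |c| cos t; by symmetry of sines the
   projection k c of b on the line spanned by c satisfies |k c - b| < |b| cos t,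
   and k <a, c> = <a, b> + <a, k c - b>. *)
Lemma dotv_gt0_of_angle a b c t : 0 <= t < pi / 2 -> 0 < dotv a b ->
  angle a b <= t -> norm2 (c - b) < norm2 c * cos t -> 0 < dotv a c.
Proof.
move=> t01 ab0 /(angle_le_dotv t01 ab0) abt cb.
have ct0 := cos_gt0_acute t01.
have ct1 : cos t <= 1 := cos_le1 t.
have /andP[a0 b0] : (0 < norm2 a) && (0 < norm2 b).
  have := lt_le_trans ab0 (dotv_le_norm2 a b).
  by have := norm2_ge0 a; have := norm2_ge0 b; nra.
have c0 : 0 < norm2 c by have := norm2_ge0 (c - b); have := norm2_ge0 c; nra.
have cb2 : norm2 (c - b) ^+ 2 < (norm2 c * cos t) ^+ 2.
  by rewrite ltr_pXn2r ?nnegrE ?norm2_ge0// mulr_ge0 ?norm2_ge0 ?ltW.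
have cbE : norm2 (c - b) ^+ 2 = norm2 c ^+ 2 - 2 * dotv b c + norm2 b ^+ 2.
  by rewrite !sqr_norm2 dotvBl !dotvBr (dotvC c b); ring.
have c2t : (norm2 c * cos t) ^+ 2 <= norm2 c ^+ 2.
  by rewrite ler_pXn2r ?nnegrE ?norm2_ge0 ?mulr_ge0 ?(ltW ct0)//
    ?ler_piMr ?norm2_ge0.
have bc0 : 0 < dotv b c.
  have : 0 < norm2 b ^+ 2 by rewrite exprn_gt0.
  by lra.
have c20 : 0 < norm2 c ^+ 2 by rewrite exprn_gt0.
pose k := dotv b c / norm2 c ^+ 2.
have k0 : 0 < k by rewrite divr_gt0.
have kc : norm2 (k *: c - b) < norm2 b * cos t.
  rewrite -(@ltr_pXn2r _ 2) ?nnegrE ?norm2_ge0 ?mulr_ge0 ?norm2_ge0//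
    ?(ltW ct0)//.
  rewrite sqr_norm2 dotvBl !dotvBr !dotvZl !dotvZr (dotvC c b) -!sqr_norm2.
  have -> : k * (k * norm2 c ^+ 2) - k * dotv b c -
      (k * dotv b c - norm2 b ^+ 2) =
      (norm2 b ^+ 2 * norm2 c ^+ 2 - dotv b c ^+ 2) / norm2 c ^+ 2.
    by rewrite /k; field; rewrite gt_eqF.
  rewrite ltr_pdivrMr//.
  (* The numerator is the Gram determinant of [b] and [c]: [norm2 b ^+ 2] times the squared distance
     from [c] to the line of [b], which is at most [norm2 (c - b) ^+ 2]. *)
  apply: (@le_lt_trans _ _ (norm2 b ^+ 2 * norm2 (c - b) ^+ 2)).
    rewrite cbE -subr_ge0.
    rewrite (_ : _ - _ = (norm2 b ^+ 2 - dotv b c) ^+ 2) ?sqr_ge0//.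
    by ring.
  have -> : (norm2 b * cos t) ^+ 2 * norm2 c ^+ 2 =
      norm2 b ^+ 2 * (norm2 c * cos t) ^+ 2 by ring.
  by rewrite ltr_pM2l ?exprn_gt0.
have := dotv_le_norm2 (- a) (k *: c - b).
rewrite dotvNl dotvBr dotvZr norm2N => acb.
have : norm2 a * norm2 (k *: c - b) < norm2 a * (norm2 b * cos t).
  by rewrite ltr_pM2l.
rewrite mulrA => akc; have : 0 < k * dotv a c by lra.
by rewrite pmulr_rgt0.
Qed.

End Angle.

(* If f increased from x along xh - x, some subgradient g of f at x would
   satisfy <g, xh - x> >= 0, whereas the bound on the angle between -g and
   xs - x forces <-g, xh - x> > 0. *)
Lemma descent_towards (R : realType) (d : nat) (f : 'rV[R]_d -> R)
    (xs xh x : 'rV[R]_d) (eps delta theta : R) :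
  convex_function [set: 'rV[R]_d] f -> 0 < eps ->
  sublevel f xs eps `<=` ball2 xs delta ->
  0 <= theta < pi / 2 ->
  (forall g, ~ sublevel f xs eps x -> subdifferential f x g ->
    angle (- g) (xs - x) <= theta) ->
  norm2 (xs - xh) * sec theta < norm2 (x - xh) ->
  norm2 (xs - xh) + delta < norm2 (x - xh) ->
  exists2 t, 0 < t & f (x + t *: (xh - x)) < f x.
Proof.
move=> fconv eps0 sub_ball theta_bnd angle_le sec_lt delta_lt.
apply: contrapT => ndesc.
have [g gx gu] : exists2 g, subdifferential f x g & 0 <= dotv g (xh - x).
  apply: (exists_subgradient fconv) => t t0; rewrite leNgt; apply/negP => ft.
  by apply: ndesc; exists t.
have xC : ~ sublevel f xs eps x.
  move=> /sub_ball; rewrite /ball2/= => xdelta.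
  have := ler_norm2D (x - xs) (xs - xh); rewrite addrA subrK; lra.
have ct0 := cos_gt0_acute theta_bnd.
(* The subgradient inequality at [xs] bounds this product below by [f x - f xs], which exceeds
   [eps]. *)
have gxs : 0 < dotv (- g) (xs - x).
  have := gx xs; move/negP: xC; rewrite -ltNge dotvNl; lra.
have := @dotv_gt0_of_angle _ _ _ _ (xh - x) _ theta_bnd gxs (angle_le _ xC gx).
rewrite opprB addrA subrK -[xh - xs]opprB norm2N -[xh - x]opprB norm2N.
rewrite -ltr_pdivrMr// => /(_ sec_lt); rewrite dotvNr dotvNl opprK.
move: gu; rewrite -[xh - x]opprB dotvNr; lra.
Qed.

(** * From descent at each regular node to descent of the average *)

Theorem proposition3 (R : realType) (d : nat) (V : finType) (Reg : {set V})
  (hReg : Reg != finset.set0)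
  (f : V -> 'rV[R]_d -> R)
  (fconv : forall i : V, convex_function [set: 'rV[R]_d] (f i))
  (argmin_neq0 : forall i : V, argmin (f i) !=set0)
  (argmin_bnd : forall i : V, bounded_set (argmin (f i)))
  (L : R) (L_gt0 : 0 < L)
  (subgrad_le : forall (i : V) (x g : 'rV[R]_d),
    subdifferential (f i) x g -> norm2 g <= L)
  (xh : 'rV[R]_d)
  (xs : V -> 'rV[R]_d)
  (xs_argmin : forall i : V, i \in Reg -> argmin (f i) (xs i))
  (delta : V -> R -> R)
  (delta_gt0 : forall (i : V) (eps : R),
    i \in Reg -> 0 < eps -> 0 < delta i eps)
  (sublevel_ball2 : forall (i : V) (eps : R), i \in Reg -> 0 < eps ->
    sublevel (f i) (xs i) eps `<=` ball2 (xs i) (delta i eps))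
  (theta : V -> R -> R)
  (theta_bnd : forall (i : V) (eps : R), i \in Reg -> 0 < eps ->
    0 <= theta i eps < pi / 2)
  (angle_le : forall (i : V) (eps : R), i \in Reg -> 0 < eps ->
    forall x g : 'rV[R]_d, ~ sublevel (f i) (xs i) eps x ->
    subdifferential (f i) x g -> angle (- g) (xs i - x) <= theta i eps)
  (xstar : 'rV[R]_d)
  (xstar_argmin : argmin (average Reg f) xstar) :
  ball2 xh (Rstar Reg xh xs delta theta) xstar.
Proof.
rewrite /ball2/=; apply: lb_le_inf.
  exists (Defs.radius Reg xh xs delta theta 1), 1 => //=; exact: ltr01.
move=> _ [eps eps0 <-]; rewrite leNgt; apply/negP => far.
have lt_far i x : i \in Reg ->
    x <= Num.max (norm2 (xs i - xh) * sec (theta i eps))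
                 (norm2 (xs i - xh) + delta i eps) ->
    x < norm2 (xstar - xh).
  move=> iR xle; apply: le_lt_trans far; apply: le_trans xle _.
  exact: (le_bigmax_cond _ _ iR).
have desc i : exists t, 0 < t /\
    (i \in Reg -> f i (xstar + t *: (xh - xstar)) < f i xstar).
  (* Outside [Reg] the step 1 is a dummy, so that [choice] ranges over all of [V]. *)
  have [iR|] := boolP (i \in Reg); last by exists 1; split=> //; exact: ltr01.
  have [||t t0 ft] := descent_towards (fconv i) eps0
    (sublevel_ball2 _ _ iR eps0) (theta_bnd _ _ iR eps0)
    (fun g => angle_le _ _ iR eps0 xstar g)
    (lt_far _ _ iR _) (lt_far _ _ iR _); rewrite ?le_max ?lexx ?orbT//.
  by exists t.
have /choice[t tP] := desc.
(* The common step; by [convex_descent] every regular [f i] still decreases at it. *)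
pose m := \big[Num.min/1]_(i in Reg) t i.
have m0 : 0 < m.
  by apply/bigmin_gtP; split=> [|i _]; [exact: ltr01|case: (tP i)].
have := xstar_argmin (xstar + m *: (xh - xstar)).
rewrite /average ler_pM2l ?invr_gt0 ?ltr0n ?card_gt0// leNgt => /negP; apply.
(* Strictness of the summed inequality needs at least one term. *)
have [i0 i0R] := finset.set0Pn _ hReg.
apply: ltr_sum => [|i iR].
  by apply/hasP; exists i0; rewrite ?mem_index_enum.
have [_ /(_ iR)] := tP i; apply: (convex_descent (fconv i)).
by rewrite m0 /m; exact: bigmin_le_cond.
Qed.
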